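(* Let $D$ be a countable dense group-like subset of $[0,\infty)$. Then there exists an aperiodic homeomorphism of a Cantor space with a good non-defective invariant measure $\widetilde{\mu}$ such that $S(\widetilde{\mu})=D$.
   Context: A Cantor space is a non-empty zero-dimensional compact perfect metric space. A homeomorphism is aperiodic if all its orbits are infinite. A Borel measure on a Cantor space $X$ is full if every non-empty open set has positive measure. $M_\infty(X)$ is the set of all full non-atomic Borel measures $\mu$ on $X$ with $\mu(X)=\infty$. For $\mu\in M_\infty(X)$ the defective set is $\mathfrak{M}_\mu=\{x\in X:\mu(U)=\infty\text{ for every clopen }U\ni x\}$. $\mu$ is non-defective if $\mu(\mathfrak{M}_\mu)=0$. For a non-defective $\mu$ the clopen values set is $S(\mu)=\{\mu(U): U\text{ clopen in }X,\ \mu(U)<\infty\}$. A non-defective measure $\mu$ is good if whenever $U,V$ are clopen subsets of $X$ with $\mu(U)<\mu(V)$, there is a clopen $W\subset V$ with $\mu(W)=\mu(U)$. A dense countable unbounded subset $D\subset[0,\infty)$ is group-like if for every $\gamma\in D$ there is an additive subgroup $G$ of $\mathbb{R}$ such that $D\cap[0,\gamma]=G\cap[0,\gamma]$. *)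

(* Defs.v *)
From HB Require Import structures.
From mathcomp Require Import all_boot all_order all_algebra.
From mathcomp Require Import all_classical all_reals all_analysis.

Set Implicit Arguments.
Unset Strict Implicit.
Unset Printing Implicit Defensive.

Import Order.TTheory GRing.Theory Num.Theory.
Import numFieldNormedType.Exports.

Local Open Scope classical_set_scope.
Local Open Scope ring_scope.
Local Open Scope ereal_scope.

(* Metric spaces with a distinguished point, i.e. non-empty ones:
   [g_sigma_algebraType] is a measurable type only over a pointed type. *)
#[short(type="pmetricType")]
HB.structure Definition PointedMetric (R : numDomainType) :=
  {M of Pointed M & Metric R M}.

Definition borel (R : realType) (X : pmetricType R) :=
  g_sigma_algebraType (@open X).

Definition homeomorphism (X : topologicalType) (T : X -> X) : Prop :=
  continuous T /\ exists2 S : X -> X, continuous S & cancel T S /\ cancel S T.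

(* For bijective [T], [iter n T y = x] says that [y] is the image of [x] under
   the [n]-th power of the inverse of [T], so this is the two-sided orbit. *)
Definition orbit (X : Type) (T : X -> X) (x : X) : set X :=
  [set y | exists n : nat, iter n T x = y \/ iter n T y = x].

Definition aperiodic (X : Type) (T : X -> X) : Prop :=
  forall x : X, infinite_set (orbit T x).

Section borel_measures.
Context (R : realType) (X : pmetricType R).
Implicit Type mu : {measure set (borel X) -> \bar R}.

Definition full_measure mu : Prop :=
  forall U : set X, open U -> U !=set0 -> 0 < mu U.

Definition is_atom mu (A : set (borel X)) : Prop :=
  [/\ measurable A, 0 < mu A &
      forall B : set (borel X),
        measurable B -> B `<=` A -> mu B < mu A -> mu B = 0].

Definition non_atomic mu : Prop := forall A : set (borel X), ~ is_atom mu A.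

Definition M_infty : set {measure set (borel X) -> \bar R} :=
  [set mu | [/\ full_measure mu, non_atomic mu & mu [set: X] = +oo]].

Definition defective_set mu : set X :=
  [set x | forall U : set X, clopen U -> U x -> mu U = +oo].

Definition non_defective mu : Prop := mu (defective_set mu) = 0.

Definition clopen_values mu : set R :=
  [set fine (mu U) | U in [set U : set X | clopen U /\ mu U < +oo]].

Definition good_measure mu : Prop :=
  forall U V : set X, clopen U -> clopen V -> mu U < mu V ->
    exists W : set X, [/\ clopen W, W `<=` V & mu W = mu U].

Definition invariant_measure (T : X -> X) mu : Prop :=
  forall A : set (borel X), measurable A -> mu (T @^-1` A) = mu A.

End borel_measures.

Local Close Scope ereal_scope.

Definition additive_subgroup (R : realType) (G : set R) : Prop :=
  G 0 /\ forall x y : R, G x -> G y -> G (x - y).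

Definition group_like (R : realType) (D : set R) : Prop :=
  [/\ D `<=` `[0, +oo[,
      `[0, +oo[ `<=` closure D,
      countable D,
      ~ has_ubound D &
      forall g : R, D g ->
        exists2 G : set R,
          additive_subgroup G & D `&` `[0, g] = G `&` `[0, g]].

(* Main.v *)
(** D is the set of non-negative elements of a countable dense subgroup G of R.
    Fix g > 0 in G and consider the countable family of the rays [a, +oo[ with
    a in G together with the square waves of period 2^(k+1) g whose phase is in
    G. The space X is the closure, in the Cantor space, of the set of
    itineraries of real numbers with respect to this family, and the measure is
    the image of the Lebesgue measure. Clopen subsets of X correspond to the
    sets of reals in the Boolean algebra generated by the family. Locally, such
    a set is a finite union of intervals with end points in G, whence goodness
    and the values; far away it is periodic, so that it has finite measure only
    if it is bounded. Translation by g permutes the family, hence induces a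
    measure-preserving homeomorphism of X. It is aperiodic because translation
    by an odd multiple of 2^k g flips the square waves of period 2^(k+1) g, and
    this persists at the points at infinity of X. *)

Require Import Defs.
From HB Require Import structures.
From mathcomp Require Import all_boot all_order all_algebra.
From mathcomp Require Import all_classical all_reals all_analysis.
From mathcomp Require Import measurable_realfun.
From mathcomp Require Import zify ring lra.

Set Implicit Arguments.
Unset Strict Implicit.
Unset Printing Implicit Defensive.

Import Order.TTheory GRing.Theory Num.Theory.
Import numFieldNormedType.Exports.

Local Open Scope classical_set_scope.
Local Open Scope ring_scope.

(** * The space of itineraries *)

(* [bitP] says that the sequence lies in the closure of the itineraries of the
   points of [T]. The field [R] is only there to fix the scalars of the metric. *)
Record itinerary (R : realType) (T : pointedType) (E : nat -> T -> bool) :=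
  Itinerary {
  bit :> nat -> bool;
  bitP : forall n, exists w, forall i, (i < n)%N -> bit i = E i w }.

Lemma ltn_bigmax (s : nat -> nat) n i :
  (i < n)%N -> (s i < \max_(j < n) (s j).+1)%N.
Proof.
by move=> ilt; rewrite (bigD1 (Ordinal ilt))//= leq_max leqnn.
Qed.

Section itinerary_space.
Context (R : realType) (T : pointedType) (E : nat -> T -> bool).
Local Notation X := (itinerary R E).
Implicit Types (x y z : X) (A : set T) (U V : set X).

Lemma itineraryP x y : x =1 y -> x = y.
Proof.
case: x y => [x Px] [y Py] /= /funext xy.
by subst y; congr Itinerary; exact: Prop_irrelevance.
Qed.

Definition encode (w : T) : X :=
  @Itinerary R T E (E ^~ w) (fun=> ex_intro _ w (fun _ _ => erefl)).

HB.instance Definition _ := gen_eqMixin X.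
HB.instance Definition _ := gen_choiceMixin X.
HB.instance Definition _ := isPointed.Build X (encode point).

Definition itinerary_dist x y : R :=
  if pselect (exists i, x i != y i) is left h then (ex_minn h).+1%:R^-1 else 0.

Lemma itinerary_dist_ltP x y n :
  (itinerary_dist x y < n.+1%:R^-1) <-> forall i, (i <= n)%N -> x i = y i.
Proof.
rewrite /itinerary_dist; case: pselect => [h|h].
  case: ex_minnP => m xym mmin; rewrite ltf_pV2 ?posrE// ltr_nat ltnS; split.
    move=> nm i ni; apply/eqP; apply: contraLR nm => /mmin mi.
    by rewrite -leqNgt (leq_trans mi).
  by move=> xy; rewrite ltnNge; apply: contra xym => /xy ->.
split=> [_ i _|_]; last by rewrite invr_gt0 ltr0n.
by apply/eqP; apply: contra_notT h => xyi; exists i.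
Qed.

Lemma itinerary_dist_lt x (e : R) : 0 < e ->
  exists n, forall z, (forall i, (i <= n)%N -> x i = z i) -> itinerary_dist x z < e.
Proof.
move=> e0; have [n ne] : exists n : nat, n.+1%:R^-1 < e.
  have := @near_infty_natSinv_lt R (PosNum e0).
  by move=> [n _ /(_ n (leqnn _))]; exists n.
by exists n => z /itinerary_dist_ltP /lt_trans; apply.
Qed.

Lemma itinerary_distxx x : itinerary_dist x x = 0.
Proof.
rewrite /itinerary_dist; case: pselect => // h; exfalso.
by case: h => i; rewrite eqxx.
Qed.

Lemma itinerary_dist_positivity x y : itinerary_dist x y = 0 -> x = y.
Proof.
move=> xy0; apply: itineraryP => i.
have /itinerary_dist_ltP -> // : itinerary_dist x y < i.+1%:R^-1.
by rewrite xy0 invr_gt0 ltr0n.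
Qed.

Lemma itinerary_dist_sym x y : itinerary_dist x y = itinerary_dist y x.
Proof.
rewrite /itinerary_dist; case: pselect => [h|h]; case: pselect => [h'|h'] //.
- case: ex_minnP => m xm mmin; case: ex_minnP => n xn nmin.
  suff -> : m = n by [].
  by apply/eqP; rewrite eqn_leq mmin 1?eq_sym// nmin 1?eq_sym.
- by exfalso; apply: h'; case: h => i; exists i; rewrite eq_sym.
- by exfalso; apply: h; case: h' => i; exists i; rewrite eq_sym.
Qed.

(** The distance is an ultrametric: if both terms on the right were smaller than
    [itinerary_dist x z], then [x] and [z] would agree, through [y], at their first disagreement. *)
Lemma itinerary_dist_triangle y x z :
  itinerary_dist x z <= itinerary_dist x y + itinerary_dist y z.
Proof.
have d0 u v : 0 <= itinerary_dist u v.
  by rewrite /itinerary_dist; case: pselect => // h; rewrite invr_ge0.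
have [xz|xz] := pselect (exists i, x i != z i); last first.
  rewrite {1}/itinerary_dist; case: pselect => [/xz//|_]; exact: addr_ge0.
have : ~ (itinerary_dist x y < itinerary_dist x z /\ itinerary_dist y z < itinerary_dist x z).
  rewrite {2 4}/itinerary_dist; case: pselect => // h; case: ex_minnP => m xzm _.
  move=> -[/itinerary_dist_ltP xy /itinerary_dist_ltP yz].
  by move/eqP: xzm; rewrite xy// yz.
move/not_andP => -[] /negP; rewrite -leNgt => h; apply: (le_trans h).
  by rewrite lerDl.
by rewrite lerDr.
Qed.

HB.instance Definition _ := @isMetric.Build R X itinerary_dist itinerary_distxx
  itinerary_dist_positivity itinerary_dist_sym itinerary_dist_triangle.

Definition cylinder n x : set X := [set y | forall i, (i < n)%N -> x i = y i].

Lemma nbhs_codeP x U : nbhs x U <-> exists n, cylinder n x `<=` U.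
Proof.
split.
  move=> /nbhs_ballP [e /= e0]; rewrite ballEmdist => eU.
  have [n nP] := itinerary_dist_lt x e0; exists n.+1 => y xy.
  by apply: eU; apply: nP => i; rewrite -ltnS; exact: xy.
move=> [n nU]; apply/nbhs_ballP; exists n.+1%:R^-1 => /=.
  by rewrite invr_gt0 ltr0n.
rewrite ballEmdist => y /itinerary_dist_ltP xy; apply: nU => i /ltnW; exact: xy.
Qed.

Lemma open_codeP U : open U <-> forall x, U x -> exists n, cylinder n x `<=` U.
Proof.
by split=> [oU x Ux|UP]; [|rewrite openE => x Ux]; apply/nbhs_codeP;
  [apply: open_nbhs_nbhs | apply: UP].
Qed.

Lemma clopen_code n U :
  (forall x y, U x -> cylinder n x y -> U y) -> clopen U.
Proof.
move=> nU; split.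
  by apply/open_codeP => x Ux; exists n => y; exact: nU.
rewrite -openC; apply/open_codeP => x nUx; exists n => y xy Uy; apply: nUx.
by apply: nU Uy _ => i /xy.
Qed.

Lemma itinerary_hausdorff : hausdorff_space X.
Proof. exact: (@metric_hausdorff R X). Qed.

Lemma itinerary_zero_dimensional : zero_dimensional X.
Proof.
move=> x y xy; have [i xyi] : exists i, x i != y i.
  apply: contrapT => /forallNP xyE; move/eqP: xy; apply; apply: itineraryP => i.
  by apply/eqP/negPn/negP; exact: xyE.
exists [set z : X | z i = x i]; split => //.
  by apply: (@clopen_code i.+1) => u v /= <- uv; rewrite uv.
by move=> /esym /eqP; exact/negP.
Qed.

(** An ultrafilter decides every bit, and the decided bits [b] form its limit. The sequences sharing
    a given prefix with [b] belong to the filter, so they exist, and [b] inherits [bitP] from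
    them. *)
Lemma itinerary_compact : compact [set: X].
Proof.
rewrite compact_ultra => F UF _.
pose b i := `[< F [set x : X | x i] >].
have Fb i : F [set x : X | b i = x i].
  rewrite /b; case: asboolP => Fi; first by apply: filterS Fi => x /= ->.
  have [//|] := in_ultra_setVsetC [set x : X | x i] UF.
  by apply: filterS => x /= /negP/negPf ->.
have Fcyl n : F [set x : X | forall i, (i < n)%N -> b i = x i].
  elim: n => [|n IHn]; first exact: filterS (@filterT _ F _).
  near=> x => i; rewrite ltnS leq_eqVlt => /predU1P[->|].
    by near: x; exact: Fb.
  by move: i; near: x.
have bP n : exists w, forall i, (i < n)%N -> b i = E i w.
  have [x xP] := filter_ex (Fcyl n).
  have [w wP] := bitP x n; exists w => i ilt.
  by rewrite xP// wP.
exists (@Itinerary R T E b bP); split => // U /nbhs_codeP [n nU].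
by apply: filterS (Fcyl n).
Unshelve. all: by end_near. Qed.

(** * Clopen sets and sets of points determined by finitely many coordinates *)

Definition depends_on_first n A :=
  forall v w, (forall i, (i < n)%N -> E i v = E i w) -> A v -> A w.

(** By compactness a single [n] serves all points: every cylinder of length [n] lies in [U] or in
    its complement. *)
Lemma clopen_depends U :
  clopen U -> exists n, depends_on_first n (encode @^-1` U).
Proof.
move=> [oU cU].
have /compact_near_coveringP/(_ _ \oo
    (fun n x => cylinder n x `<=` U \/ cylinder n x `<=` ~` U)) := itinerary_compact.
case=> [x _|n _ /(_ n (leqnn n)) nP].
  have [m mP] : exists m, cylinder m x `<=` U \/ cylinder m x `<=` ~` U.
    have [Ux|nUx] := pselect (U x).
      by move/open_codeP : oU => /(_ _ Ux) [m]; exists m; left.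
    move: cU; rewrite -openC => /open_codeP /(_ _ nUx) [m].
    by exists m; right.
  exists (cylinder m x, [set n | (m <= n)%N]).
    by split; [apply/nbhs_codeP; exists m | exists m].
  move=> [y n] /= [xy mn].
  have sub : cylinder n y `<=` cylinder m x.
    by move=> z yz i im; rewrite xy// yz// (leq_trans im).
  by case: mP => mP; [left | right]; exact: subset_trans mP.
exists n => v w vw Uv.
have [] := nP (encode v) I.
  by apply=> i /vw.
by move=> /(_ (encode v)) /(_ (fun _ _ => erefl)).
Qed.

Lemma depends_clopen n A :
  depends_on_first n A -> exists2 U, clopen U & encode @^-1` U = A.
Proof.
move=> nA; exists [set x | exists2 w, A w & cylinder n x (encode w)].
  apply: (@clopen_code n) => x y /= [w Aw xw] xy; exists w => // i ilt.
  by rewrite -xw// xy.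
apply/seteqP; split=> [w [v Av wv]|w Aw]; last by exists w.
by apply: nA Av => i /wv.
Qed.

Lemma open_meets_encode U :
  open U -> U !=set0 ->
  exists2 V, clopen V & V `<=` U /\ exists w, V (encode w).
Proof.
move=> /open_codeP oU [x /oU [n nU]]; exists (cylinder n x).
  by apply: (@clopen_code n) => y z xy yz i ilt; rewrite xy// yz.
by split=> //; have [w wP] := bitP x n; exists w.
Qed.

(** Encoded points are dense, so the difference of [U] and [V], being open, would contain one if it
    were non-empty. *)
Lemma clopen_subset U V :
  clopen U -> clopen V -> encode @^-1` U `<=` encode @^-1` V -> U `<=` V.
Proof.
move=> [oU cU] [oV cV] UV; apply: contrapT => /existsNP [x /not_implyP [Ux nVx]].
have oUV : open (U `&` ~` V) by apply: openI => //; rewrite openC.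
have UV0 : U `&` ~` V !=set0 by exists x.
by have [W _ [WUV [w /WUV[/UV]]]] := open_meets_encode oUV UV0.
Qed.

Lemma open_bigcup_depends U : open U ->
  exists2 F : nat -> set T,
    forall n, depends_on_first n (F n) & encode @^-1` U = \bigcup_n F n.
Proof.
move=> /open_codeP oU.
exists (fun n => [set w | cylinder n (encode w) `<=` U]).
  move=> n v w vw vU; apply: subset_trans vU => x wx i ilt.
  by rewrite -wx//= vw.
apply/seteqP; split=> [w /oU [n nU]|w [n _]]; first by exists n.
exact.
Qed.

Lemma itinerary_perfect :
  (forall n w, exists2 v, forall i, (i < n)%N -> E i w = E i v &
                          exists i, E i v != E i w) ->
  perfect_set [set: X].
Proof.
move=> splitE; split; first exact: closedT.
apply/seteqP; split=> // x _ U /nbhs_codeP [n nU].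
have [w xw] := bitP x n; have [v wv [i vwi]] := splitE n w.
(* Both [encode w] and [encode v] lie in the neighbourhood and they are distinct, so one of them
   differs from [x]. *)
have [xE|/eqP xE] := pselect (x = encode w).
  exists (encode v); split=> //; last by apply: nU => k kn /=; rewrite -wv// xw.
  by apply: contraNneq vwi; rewrite xE => /(congr1 (fun y : X => y i)) /= ->.
by exists (encode w); split=> //; [rewrite eq_sym | apply: nU].
Qed.

(** * Continuous maps induced by maps of the base points *)

Section recode.
Variables (s : nat -> nat) (f : T -> T).
Hypothesis sf : forall i w, E (s i) w = E i (f w).

Lemma recodeP x n : exists w, forall i, (i < n)%N -> x (s i) = E i w.
Proof.
have [w wP] := bitP x (\max_(i < n) (s i).+1).
exists (f w) => i ilt; rewrite -sf wP//.
exact: ltn_bigmax.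
Qed.

(** The extension of [f] from the encoded points to their limits. *)
Definition recode x : X := @Itinerary R T E (x \o s) (recodeP x).

Lemma reitinerary_encode w : recode (encode w) = encode (f w).
Proof. by apply: itineraryP => i /=; rewrite sf. Qed.

Lemma reitinerary_continuous : continuous recode.
Proof.
move=> x U /nbhs_codeP [n nU]; apply/nbhs_codeP.
exists (\max_(i < n) (s i).+1)%N => y xy; apply: nU => i ilt /=.
by apply: xy; exact: ltn_bigmax.
Qed.

End recode.

(** A relation between two members of the family involves only two bits, so it passes from encoded
    points to their limits; the same holds for negation below. *)
Lemma bit_eq x i j : E i =1 E j -> x i = x j.
Proof.
move=> ij; have [w wP] := bitP x (maxn i j).+1.
by rewrite !wP ?ltnS ?leq_maxl ?leq_maxr.
Qed.

Lemma bit_neg x i j : (forall w, E i w = ~~ E j w) -> x i = ~~ x j.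
Proof.
move=> ij; have [w wP] := bitP x (maxn i j).+1.
by rewrite !wP ?ltnS ?leq_maxl ?leq_maxr.
Qed.

End itinerary_space.
(** * Intervals with end points in a subgroup *)

(* [P a b] stands for a property of the interval [a, b[ ; [pieced G P a b] means
   that this interval can be cut at points of [G] into finitely many intervals
   satisfying [P]. *)
Inductive pieced (R : realType) (G : set R) (P : R -> R -> Prop) :
    R -> R -> Prop :=
| piece a b of G a & G b & a <= b & P a b : pieced G P a b
| piece_cat a b c of pieced G P a b & pieced G P b c : pieced G P a c.

Section pieced.
Context (R : realType) (G : set R).
Implicit Types (P Q : R -> R -> Prop) (a b c d : R).

Definition hereditary P :=
  forall a b c d, a <= c -> c <= d -> d <= b -> P a b -> P c d.

Lemma pieced_bounds P a b : pieced G P a b -> [/\ G a, G b & a <= b].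
Proof.
by elim=> // {}a {}b c _ [Ga Gb ab] _ [_ Gc bc]; split; rewrite ?(le_trans ab).
Qed.

Lemma pieced_mono P Q a b :
  (forall c d, P c d -> Q c d) -> pieced G P a b -> pieced G Q a b.
Proof.
move=> PQ; elim=> [{}a {}b Ga Gb ab /PQ|{}a {}b c _ ab _ bc].
  exact: piece.
exact: piece_cat ab bc.
Qed.

(** Each piece for [P] is cut further for [Q]; heredity keeps [P] on the smaller pieces. *)
Lemma pieced_and P Q a b : hereditary P -> pieced G P a b ->
    (forall c d, G c -> G d -> c <= d -> pieced G Q c d) ->
  pieced G (fun c d => P c d /\ Q c d) a b.
Proof.
move=> hP Pab QG; elim: Pab => [{}a {}b Ga Gb ab|{}a {}b c _ ab _ bc].
  have := QG _ _ Ga Gb ab; elim.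
    by move=> c d Gc Gd cd Qcd Pcd; exact: piece.
  move=> c d e Qcd IHcd Qde IHde Pce.
  have [_ _ cd] := pieced_bounds Qcd; have [_ _ de] := pieced_bounds Qde.
  apply: (@piece_cat _ _ _ _ d); [apply: IHcd|apply: IHde].
    exact: hP Pce.
  exact: hP Pce.
exact: piece_cat ab bc.
Qed.

Lemma pieced_containing P a b x : hereditary P -> pieced G P a b ->
  a <= x < b -> exists c d, [/\ G c, G d, a <= c <= x, x < d <= b & P c d].
Proof.
move=> hP; elim=> [{}a {}b Ga Gb _ Pab /andP[ax xb]|{}a {}b c ab IHab bc IHbc].
  by exists a, b; split; rewrite ?lexx ?ax ?xb.
move=> /andP[ax xc]; have [_ _ leab] := pieced_bounds ab.
have [_ _ lebc] := pieced_bounds bc.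
have [xb|bx] := ltP x b.
  have [|d [e [Gd Ge /andP[ad dx] /andP[xe eb] Pde]]] := IHab.
    by rewrite ax.
  by exists d, e; split; rewrite ?ad ?xe ?(le_trans eb).
have [|d [e [Gd Ge /andP[ad dx] /andP[xe eb] Pde]]] := IHbc.
  by rewrite bx.
by exists d, e; split; rewrite ?dx ?andbT ?xe ?(le_trans leab).
Qed.

Hypotheses (G0 : G 0) (GB : forall x y, G x -> G y -> G (x - y)).

Lemma subgroupN x : G x -> G (- x).
Proof. by move=> Gx; rewrite -sub0r; exact: GB. Qed.

Lemma subgroupD x y : G x -> G y -> G (x + y).
Proof. by move=> Gx Gy; rewrite -[y]opprK; apply/GB/subgroupN. Qed.

Lemma subgroupMn x n : G x -> G (n%:R * x).
Proof.
move=> Gx; elim: n => [|n IHn]; first by rewrite mul0r.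
by rewrite -natr1 mulrDl mul1r; exact: subgroupD.
Qed.

Lemma subgroupMz x (z : int) : G x -> G (z%:~R * x).
Proof.
move=> Gx; case: z => n; first exact: subgroupMn.
by rewrite NegzE mulrNz mulNr; apply/subgroupN/subgroupMn.
Qed.

Lemma pieced_grid s h a b : G s -> G h -> 0 < h -> G a -> G b -> a <= b ->
  pieced G (fun c d => exists z : int, s + z%:~R * h <= c /\
                                       d <= s + (z + 1)%:~R * h) a b.
Proof.
move=> Gs Gh h0 Ga Gb ab.
suff grid n (z : int) c : G c -> c <= b -> s + z%:~R * h <= c ->
    c <= s + (z + 1)%:~R * h -> b <= s + (z + n%:Z)%:~R * h ->
    pieced G (fun c d => exists z : int, s + z%:~R * h <= c /\
                                         d <= s + (z + 1)%:~R * h) c b.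
  have /andP[za az] := floor_itv ((a - s) / h).
  (* The added 1 makes up for the part of the first cell that lies to the left of [a]. *)
  pose n := Num.bound ((b - a) / h + 1).
  apply: (grid n (Num.floor ((a - s) / h))) => //.
  - by rewrite -lerBrDl -ler_pdivlMr.
  - by rewrite -lerBlDl -ler_pdivrMr// ltW.
  rewrite -lerBlDl -ler_pdivrMr// intrD.
  have : (b - a) / h + 1 < n%:R by rewrite archi_boundP// addr_ge0// divr_ge0 ?subr_ge0// ltW.
  move: az; rewrite intrD.
  have -> : (b - s) / h = (b - a) / h + (a - s) / h by field; rewrite gt_eqF.
  rewrite pmulrn; lra.
elim: n z c => [|n IHn] z c Gc cb zc cz bz.
  apply: piece => //; exists z; split=> //.
  move: bz; rewrite addr0 => /le_trans; apply.
  by rewrite lerD2l ler_pM2r// ler_int lerDl.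
have [bz1|z1b] := leP b (s + (z + 1)%:~R * h).
  by apply: piece => //; exists z.
apply: (@piece_cat _ _ _ _ (s + (z + 1)%:~R * h)).
  apply: piece => //; last by exists z.
  by apply: subgroupD => //; exact: subgroupMz.
apply: IHn => //.
- by apply: subgroupD => //; exact: subgroupMz.
- exact: ltW.
- by rewrite lerD2l ler_pM2r// ler_int lerDl.
- by rewrite (le_trans bz)// -addrA -PoszD add1n.
Qed.

Definition constant_on (A : R -> bool) a b :=
  forall x y, a <= x < b -> a <= y < b -> A x = A y.

Lemma hereditary_constant_on A : hereditary (constant_on A).
Proof.
move=> a b c d ac cd db Aab x y /andP[cx xd] /andP[cy yd].
by apply: Aab; rewrite (le_trans ac)//= (lt_le_trans _ db).
Qed.

Lemma pieced_ray c a b : G c -> G a -> G b -> a <= b ->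
  pieced G (constant_on (fun x => c <= x)) a b.
Proof.
move=> Gc Ga Gb ab; have [ca|ac] := leP c a.
  by apply: piece => // x y /andP[ax _] /andP[ay _]; rewrite !(le_trans ca).
have [bc|cb] := leP b c.
  apply: piece => // x y /andP[_ xb] /andP[_ yb].
  by rewrite !leNgt !(lt_le_trans _ bc).
apply: (@piece_cat _ _ _ _ c).
  apply: piece (ltW ac) _ => // x y /andP[_ xb] /andP[_ yb].
  by rewrite !leNgt xb yb.
apply: piece (ltW cb) _ => // x y /andP[ax _] /andP[ay _].
by rewrite ax ay.
Qed.

Lemma pieced_floor (f : int -> bool) s h a b :
  G s -> G h -> 0 < h -> G a -> G b -> a <= b ->
  pieced G (constant_on (fun x => f (Num.floor ((x - s) / h)))) a b.
Proof.
move=> Gs Gh h0 Ga Gb ab; apply: pieced_mono (pieced_grid Gs Gh h0 Ga Gb ab).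
move=> c d [z [zc dz]].
have fl x : c <= x < d -> Num.floor ((x - s) / h) = z.
  move=> /andP[cx xd]; apply/eqP; rewrite floor_eq.
  rewrite ler_pdivlMr// ltr_pdivrMr// lerBrDl ltrBlDl.
  by rewrite (le_trans zc)//= (lt_le_trans xd).
by move=> x y /fl -> /fl ->.
Qed.

End pieced.
(** * The Boolean algebra of finitary sets *)

Lemma pushforward_measure d d' (T1 : measurableType d) (T2 : measurableType d')
    (R : realFieldType) (mu : {measure set T1 -> \bar R}) (f : T1 -> T2) :
  measurable_fun [set: T1] f ->
  exists nu : {measure set T2 -> \bar R}, forall A, nu A = mu (f @^-1` A).
Proof.
move=> mf; have [nu nuE] :
    exists nu : {measure set T2 -> \bar R}, nu = pushforward mu f :> (_ -> _).
  by unshelve eexists (Measure.clone _ _ _ (pushforward mu f) _).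
by exists nu => A; rewrite nuE.
Qed.

Lemma lebesgue_measure_itvco (R : realType) (a b : R) : a <= b ->
  lebesgue_measure `[a, b[ = (b - a)%:E.
Proof.
rewrite lebesgue_measure_itv/= lte_fin le_eqVlt => /predU1P[->|->//].
by rewrite ltxx subrr.
Qed.

(** The image of Lebesgue measure under the translation has the right values on half-open intervals,
    so uniqueness applies. *)
Lemma lebesgue_measure_shift (R : realType) (g : R)
    (A : set (measurableTypeR R)) : measurable A ->
  lebesgue_measure [set x : measurableTypeR R | A (x + g)] =
  lebesgue_measure A.
Proof.
move=> mA.
pose f (x : measurableTypeR R) : measurableTypeR R := x + g.
have mf : measurable_fun [set: measurableTypeR R] f by exact: measurable_funD.
have [nu nuE] := pushforward_measure lebesgue_measure mf.
have -> : [set x : measurableTypeR R | A (x + g)] =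
          f @^-1` A by [].
rewrite -nuE; apply/esym; apply: (lebesgue_measure_unique (mu := nu)) mA.
move=> _ [[a b] _ <-].
rewrite nuE.
have -> : f @^-1` `]a, b] = `]a - g, b - g]%classic.
  by apply/seteqP; split=> x; rewrite /= !in_itv/= ltrBlDr lerBrDr.
transitivity (lebesgue_measure (`]a - g, b - g]%classic : set R)) => //.
rewrite !lebesgue_measure_itv/= !lte_fin ltrD2r.
by case: ifP => // _; rewrite -!EFinB opprB addrA subrK.
Qed.
Section finitary.
Context (T : pointedType) (E : nat -> T -> bool).
Implicit Types A B : set T.

(** Membership in the Boolean algebra generated by the sets on which some [E i] holds. *)
Definition finitary A := exists n, depends_on_first E n A.

Lemma depends_on_firstW m n A : (m <= n)%N ->
  depends_on_first E m A -> depends_on_first E n A.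
Proof. by move=> mn mA v w vw; apply: mA => i im; rewrite vw// (leq_trans im). Qed.

Lemma finitaryC A : finitary A -> finitary (~` A).
Proof.
move=> [n nA]; exists n => v w vw nAv Aw; apply: nAv.
by apply: nA Aw => i /vw.
Qed.

Lemma finitaryI A B : finitary A -> finitary B -> finitary (A `&` B).
Proof.
move=> [m mA] [n nB]; exists (maxn m n) => v w vw [Av Bv]; split.
  by apply: depends_on_firstW vw Av; first exact: leq_maxl.
by apply: depends_on_firstW vw Bv; first exact: leq_maxr.
Qed.

Lemma finitary_coordinate i : finitary [set w | E i w].
Proof. by exists i.+1 => v w /= <-. Qed.

End finitary.

(** * Finitary sets of reals and their Lebesgue measure *)

Section interval_algebra.
Context (R : realType) (G : set R) (E : nat -> R -> bool) (g : R).
Local Notation lambda := (@lebesgue_measure R).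
Implicit Types (A : set (measurableTypeR R)) (a b c d x y : R).
Hypotheses (G0 : G 0) (GB : forall x y, G x -> G y -> G (x - y)).
Hypotheses (Gg : G g) (g0 : 0 < g).
Hypothesis Gsmall : forall e, 0 < e -> exists2 c, G c & 0 < c < e.
Hypothesis Epiece : forall i a b, G a -> G b -> a <= b ->
  pieced G (constant_on (E i)) a b.
Hypothesis Eray : forall a, G a -> exists i, forall x, E i x = (a <= x).
Hypothesis Eperiodic : forall i, exists N k : nat,
  forall m, (k <= m)%N -> forall x : R,
    (N%:R <= x -> E i (x + 2 ^+ m * g) = E i x) /\
    (x < - N%:R -> E i (x - 2 ^+ m * g) = E i x).

Lemma pieced_prefix n a b : G a -> G b -> a <= b ->
  pieced G (fun c d => forall i, (i < n)%N -> constant_on (E i) c d) a b.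
Proof.
elim: n a b => [|n IHn] a b Ga Gb ab; first exact: piece.
have := @pieced_and _ G _ (constant_on (E n)) _ _ _ (IHn a b Ga Gb ab).
move=> /(_ _ (Epiece n)) H; apply: pieced_mono (H _).
  move=> c d [cdn Ecd] i; rewrite ltnS leq_eqVlt => /predU1P[->//|].
  exact: cdn.
move=> p q r s pr rs sq Ppq i /Ppq.
exact: hereditary_constant_on.
Qed.

Lemma pieced_finitary A a b : finitary E A -> G a -> G b -> a <= b ->
  pieced G (constant_on (fun x => x \in A)) a b.
Proof.
move=> [n nA] Ga Gb ab; apply: pieced_mono (pieced_prefix n Ga Gb ab).
move=> c d cd x y xcd ycd; apply/idP/idP; rewrite !inE; apply: nA => i /cd Ei.
  exact: Ei.
exact: Ei.
Qed.

Lemma finitary_itvco a b : G a -> G b -> finitary E `[a, b[%classic.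
Proof.
move=> /Eray [i iE] /Eray [j jE].
have -> : `[a, b[%classic = [set x | E i x] `&` ~` [set x | E j x].
  apply/seteqP; split=> x; rewrite /= in_itv/= iE jE ltNge.
    by move=> /andP[-> /negP].
  by move=> [-> /negP ->].
apply: finitaryI; last apply: finitaryC; exact: finitary_coordinate.
Qed.

(** End points that are multiples of [g] keep these windows in the algebra while they exhaust the
    line. *)
Definition box (n : nat) : set R := `[- (n%:R * g), n%:R * g[%classic.

Lemma G_box n : G (- (n%:R * g)) /\ G (n%:R * g).
Proof.
have Gn := subgroupMn G0 GB n Gg.
by split=> //; exact: subgroupN.
Qed.

Lemma box_bounds n : - (n%:R * g) <= n%:R * g.
Proof. by rewrite ge0_cp// mulr_ge0// ltW. Qed.

Lemma box_exists x : exists n : nat, - (n%:R * g) <= x < n%:R * g.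
Proof.
exists (Num.bound (`|x| / g)).
have : `|x| / g < (Num.bound (`|x| / g))%:R by rewrite archi_boundP// divr_ge0// ltW.
by rewrite ltr_pdivrMr// ltr_norml => /andP[/ltW -> ->].
Qed.

Lemma bigcup_box : \bigcup_n box n = setT.
Proof.
by apply/seteqP; split=> // x _; have [n xn] := box_exists x; exists n.
Qed.

Lemma le_box m n : (m <= n)%N -> box m `<=` box n.
Proof.
move=> mn x; rewrite /box/= !in_itv/= => /andP[mx xm].
have mng : m%:R * g <= n%:R * g by rewrite ler_pM2r// ler_nat.
by rewrite (lt_le_trans xm)// (le_trans _ mx)// lerN2.
Qed.

Lemma finitary_box n : finitary E (box n).
Proof. by have [Gm Gn] := G_box n; exact: finitary_itvco. Qed.

Lemma constant_on_itvco A a b : constant_on (fun x => x \in A) a b ->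
  A `&` `[a, b[%classic = set0 \/ `[a, b[%classic `<=` A.
Proof.
move=> Aab; have [[x [Ax xab]]|] := pselect (A `&` `[a, b[%classic !=set0).
  by right=> y yab; apply/set_mem; rewrite -(Aab x y xab yab); exact: mem_set.
by move=> /set0P/negP/negPn/eqP; left.
Qed.

Lemma setI_itvco_cat A a b c : a <= b <= c ->
  A `&` `[a, c[%classic =
  (A `&` `[a, b[%classic) `|` (A `&` `[b, c[%classic).
Proof.
move=> /andP[ab bc]; rewrite -setIUr; congr (_ `&` _); apply/seteqP; split=> x.
  rewrite /= !in_itv/= => /andP[-> ->]; rewrite andbT.
  by have [_|] := ltP x b; [left|right].
rewrite /= !in_itv/= => -[/andP[ax xb]|/andP[bx xc]].
  by rewrite ax (lt_le_trans xb).
by rewrite (le_trans ab).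
Qed.

Lemma measure_setI_itvco_cat A a b c : a <= b <= c ->
  measurable (A `&` `[a, b[%classic) -> measurable (A `&` `[b, c[%classic) ->
  lambda (A `&` `[a, c[%classic) =
  (lambda (A `&` `[a, b[%classic) + lambda (A `&` `[b, c[%classic))%E.
Proof.
move=> abc mab mbc; rewrite (setI_itvco_cat A abc) measureU//.
rewrite -subset0 => x [[_ +] [_]]; rewrite /= !in_itv/= => /andP[_ xb] /andP[].
by rewrite leNgt xb.
Qed.

Lemma pieced_measurable A a b : pieced G (constant_on (fun x => x \in A)) a b ->
  measurable (A `&` `[a, b[%classic).
Proof.
elim=> [{}a {}b _ _ _ /constant_on_itvco[->//|/setIidPr ->]|{}a {}b c Pab mab Pbc mbc].
  exact: measurable_itv.
have [_ _ ab] := pieced_bounds Pab; have [_ _ bc] := pieced_bounds Pbc.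
rewrite (@setI_itvco_cat _ _ b) ?ab//; exact: measurableU.
Qed.

Lemma finitary_measurable A : finitary E A -> measurable A.
Proof.
move=> fA; rewrite -(setIT A) -bigcup_box setI_bigcupr.
apply: bigcup_measurable => n _; apply: pieced_measurable.
by have [Gm Gn] := G_box n; apply: pieced_finitary => //; exact: box_bounds.
Qed.

(** Between [a] and [b] the set [A] consists of finitely many intervals with end points in [G]. A
    cut point moving to the right from [a] thus cuts off any measure in [G] up to the total [v]. *)
Lemma pieced_chop A a b : pieced G (constant_on (fun x => x \in A)) a b ->
  exists v, [/\ G v, 0 <= v, lambda (A `&` `[a, b[%classic) = v%:E &
    forall d, G d -> 0 <= d <= v ->
      exists t, [/\ G t, a <= t <= b & lambda (A `&` `[a, t[%classic) = d%:E]].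
Proof.
elim=> [{}a {}b Ga Gb ab /constant_on_itvco[A0|abA]|{}a {}b c Pab + Pbc].
- exists 0; rewrite A0 measure0; split=> // d _ /andP[d0 d0'].
  have -> : d = 0 by apply/eqP; rewrite eq_le d0 d0'.
  by exists a; rewrite lexx ab set_itvco0 setI0 measure0.
- exists (b - a); rewrite subr_ge0 (setIidr abA) lebesgue_measure_itvco//.
  split=> //; first exact: GB.
  move=> d Gd /andP[d0 dba]; have ab' : a + d <= b by rewrite -lerBrDl.
  exists (a + d); split; [exact: subgroupD|by rewrite lerDl d0|].
  rewrite setIidr ?lebesgue_measure_itvco ?lerDl//.
    by rewrite addrC addKr.
  apply: subset_trans abA => x; rewrite /= !in_itv/= => /andP[-> /=] xd.
  exact: lt_le_trans ab'.
move=> [v [Gv v0 vE vP]] [w [Gw w0 wE wP]].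
have [_ _ ab] := pieced_bounds Pab; have [_ _ bc] := pieced_bounds Pbc.
have mab := pieced_measurable Pab; have mbc := pieced_measurable Pbc.
exists (v + w); split; [exact: subgroupD|exact: addr_ge0| |].
  by rewrite (@measure_setI_itvco_cat _ _ b) ?ab// vE wE.
(* If [d <= v], the cut falls in the first part; otherwise the first part is kept whole and [d - v]
   is cut off from the second. *)
move=> d Gd /andP[d0 dvw]; have [dv|vd] := leP d v.
  have [|t [Gt /andP[at_ tb] tE]] := vP d Gd; first by rewrite d0.
  by exists t; rewrite at_ (le_trans tb).
have [||t [Gt /andP[bt tc] tE]] := wP (d - v); first exact: GB.
  by rewrite subr_ge0 ltW//= lerBlDl.
exists t; rewrite (le_trans ab)// tc; split=> //.
rewrite (@measure_setI_itvco_cat _ _ b) ?ab ?bt//.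
  by rewrite vE tE -EFinD addrC subrK.
have -> : A `&` `[b, t[%classic = (A `&` `[b, c[%classic) `&` `[b, t[%classic.
  rewrite -setIA; congr (_ `&` _); apply/esym/setIidr => x.
  by rewrite /= !in_itv/= => /andP[-> /= xt]; exact: lt_le_trans tc.
by apply: measurableI => //; exact: measurable_itv.
Qed.

(** Continuity from below along the boxes: a bound by [r] on all of them would pass to the limit. *)
Lemma measure_box A (r : R) : measurable A -> (r%:E < lambda A)%E ->
  exists n, (r%:E < lambda (A `&` box n))%E.
Proof.
move=> mA; apply: contraPP => /forallNP rA; apply/negP; rewrite -leNgt.
have mbox n : measurable (A `&` box n).
  by apply: measurableI => //; exact: measurable_itv.
have UA : \bigcup_n (A `&` box n) = A by rewrite -setI_bigcupr bigcup_box setIT.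
have cvgA : (lambda (A `&` box n) @[n --> \oo] --> lambda A)%E.
  rewrite -[in X in _ --> X]UA; apply: nondecreasing_cvg_mu => //.
    by rewrite UA.
  by move=> m n mn; apply/subsetPset => x [Ax mx]; split=> //; exact: le_box mx.
rewrite -(cvg_lim _ cvgA)//; apply: lime_le; first by apply/cvg_ex; exists (lambda A).
by near=> n; rewrite leNgt; apply/negP; exact: rA.
Unshelve. all: by end_near. Qed.

(** This is goodness on the line: inside a large box, [A] is cut at a suitable point of [G]. *)
Lemma finitary_chop A (r : R) : finitary E A -> G r -> 0 <= r ->
  (r%:E < lambda A)%E ->
  exists B, [/\ finitary E B, B `<=` A & lambda B = r%:E].
Proof.
move=> fA Gr r0 /(measure_box (finitary_measurable fA)) [n].
have [Gm Gn] := G_box n.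
have [v [Gv v0 -> vP]] := pieced_chop (pieced_finitary fA Gm Gn (box_bounds n)).
rewrite lte_fin => /ltW rv; have [|t [Gt _ tE]] := vP r Gr; first by rewrite r0.
exists (A `&` `[- (n%:R * g), t[%classic); split=> //.
by apply: finitaryI => //; exact: finitary_itvco.
Qed.

Lemma finitary_contains A x a b : finitary E A -> A x -> G a -> G b ->
  a <= x < b ->
  exists c d, [/\ G c, G d, a <= c <= x, x < d <= b & `[c, d[%classic `<=` A].
Proof.
move=> fA Ax Ga Gb axb; have /andP[ax xb] := axb.
have Aab := pieced_finitary fA Ga Gb (ltW (le_lt_trans ax xb)).
have [c [d [Gc Gd acx xdb Acd]]] :=
  pieced_containing (@hereditary_constant_on _ _) Aab axb.
exists c, d; split=> // y ycd; apply/set_mem; rewrite (Acd y x)//.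
  exact: mem_set.
by case/andP: acx => _ ->; case/andP: xdb.
Qed.

(** The step is at least as long as the interval, so the translates are disjoint, and all have the
    same positive measure. *)
Lemma measure_progression A c d (l : R) : measurable A -> c < d ->
  d - c <= `|l| ->
  (forall m : nat, `[c + m%:R * l, d + m%:R * l[%classic `<=` A) ->
  lambda A = +oo%E.
Proof.
move=> mA cd dcl FA; pose F (m : nat) : set (measurableTypeR R) :=
  `[c + m%:R * l, d + m%:R * l[%classic.
have mF m : measurable (F m) by exact: measurable_itv.
have tF : trivIset setT F.
  move=> m n _ _ [x []]; rewrite /F/= !in_itv/= => /andP[mx xm] /andP[nx xn].
  (* The left end points of two translates that meet differ by less than the common length. *)
  have : `|(m%:Z - n%:Z)%:~R * l| < `|l|.
    apply: lt_le_trans dcl; rewrite intrD mulrDl mulrNz mulNr -!pmulrn ltr_norml.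
    by apply/andP; split; lra.
  rewrite normrM gtr_pMl; last by apply: lt_le_trans dcl; rewrite subr_gt0.
  by rewrite -intr_norm ltrz1; lia.
have lF m : lambda (F m) = (d - c)%:E.
  by rewrite lebesgue_measure_itvco ?lerD2r ?(ltW cd)// opprD addrACA subrr addr0.
apply/eqyP => M M0; have dc0 : 0 < d - c by rewrite subr_gt0.
pose n := Num.bound (M / (d - c)).
apply: (@le_trans _ _ (lambda (\big[setU/set0]_(i < n) F i))); last first.
  apply: le_measure; rewrite ?inE//; first exact: bigsetU_measurable.
  by rewrite -bigcup_mkord; apply: bigcup_sub => i _; exact: FA.
rewrite (measure_bigsetU lambda mF tF).
rewrite (eq_bigr (fun=> (d - c)%:E)) => [|i _]; last exact: lF.
rewrite sumEFin lee_fin sumr_const card_ord -[leRHS]mulr_natl -ler_pdivrMr//.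
by rewrite ltW// archi_boundP// divr_ge0// ltW.
Qed.

(** Only finitely many coordinates matter, and each one is periodic for all exponents from some
    point on, so maxima of the bounds serve them all. *)
Lemma finitary_periodic A : finitary E A -> exists N k : nat, forall x : R,
  (N%:R <= x -> A x -> A (x + 2 ^+ k * g)) /\
  (x < - N%:R -> A x -> A (x - 2 ^+ k * g)).
Proof.
move=> [n nA]; suff [N [k Nk]] : exists N k : nat,
    forall i, (i < n)%N -> forall m, (k <= m)%N -> forall x : R,
    (N%:R <= x -> E i (x + 2 ^+ m * g) = E i x) /\
    (x < - N%:R -> E i (x - 2 ^+ m * g) = E i x).
  exists N, k => x; split=> Nx; apply: nA => i ilt.
    by have [->] := Nk i ilt k (leqnn k) x.
  by have [_ ->] := Nk i ilt k (leqnn k) x.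
elim: n {nA} => [|n [N [k IHn]]]; first by exists 0%N, 0%N.
have [N' [k' Hn]] := Eperiodic n.
exists (maxn N N'), (maxn k k') => i ilt m; rewrite geq_max => /andP[km k'm] x.
have leN : N%:R <= (maxn N N')%:R :> R by rewrite ler_nat leq_maxl.
have leN' : N'%:R <= (maxn N N')%:R :> R by rewrite ler_nat leq_maxr.
move: ilt; rewrite ltnS leq_eqVlt => /predU1P[->|ilt].
  have [H1 H2] := Hn m k'm x; split=> Nx; first by apply: H1; lra.
  by apply: H2; lra.
have [H1 H2] := IHn i ilt m km x; split=> Nx; first by apply: H1; lra.
by apply: H2; lra.
Qed.

(* Far away, [A] is stable under translations of a fixed length directed away
   from the origin, so an interval contained in [A] there has infinitely many
   disjoint translates in [A]. *)
Lemma finitary_bounded A : finitary E A -> (lambda A < +oo)%E ->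
  exists n, A `<=` box n.
Proof.
move=> fA; apply: contraPP => /forallNP unbounded.
suff -> : lambda A = +oo%E by [].
have mA := finitary_measurable fA.
have [N [k Nk]] := finitary_periodic fA; set L := 2 ^+ k * g in Nk.
have L0 : 0 < L by rewrite mulr_gt0// exprn_gt0.
pose n := Num.bound (N%:R / g).
have Nn : N%:R < n%:R * g by rewrite -ltr_pdivrMr// archi_boundP// divr_ge0// ltW.
have /existsNP [x /not_implyP [Ax]] := unbounded n.
have [Gm Gn] := G_box n; have [p xp] := box_exists x; have [Gm' Gp] := G_box p.
have progress c d l : l = L \/ l = - L -> c < d -> `[c, d[%classic `<=` A ->
    (forall y m, c + m%:R * l <= y < d + m%:R * l -> A y -> A (y + l)) ->
    lambda A = +oo%E.
  (* The interval is shortened to length at most [L] to make its translates disjoint. *)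
  move=> lL cd cdA lA; pose e := Num.min d (c + L).
  have ed : e <= d by rewrite ge_min lexx.
  have ec : e <= c + L by rewrite ge_min lexx orbT.
  apply: (@measure_progression _ c e l) => //.
  - by rewrite lt_min cd ltrDl.
  - by case: lL => ->; rewrite ?normrN gtr0_norm// lerBlDl.
  elim=> [|m IHm] y; rewrite /= in_itv/=.
    rewrite mul0r !addr0 => /andP[cy ye]; apply: cdA.
    by rewrite /= in_itv/= cy (lt_le_trans ye).
  rewrite -natr1 mulrDl mul1r => ycd; rewrite -(subrK l y).
  have yl : c + m%:R * l <= y - l < e + m%:R * l.
    by move: ycd => /andP[? ?]; apply/andP; split; lra.
  apply: (lA _ m); last by apply: IHm; rewrite /= in_itv.
  by move: yl => /andP[-> /lt_le_trans]; apply; rewrite lerD2r.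
case/andP: xp => mpx xp.
move=> /negP; rewrite in_itv/= negb_and -ltNge -leNgt => /orP[xn|nx].
  (* Cutting at the edge of the box keeps the interval around [x] below [- N], where translation by
     [- L] preserves [A]; the other side is symmetric. *)
  have [|c [d [Gc Gd /andP[_ cx] /andP[xd dn] cdA]]] :=
    finitary_contains fA Ax Gm' Gm _.
    by rewrite mpx.
  apply: (progress c d (- L)) => //; [by right|exact: le_lt_trans xd|].
  move=> y m /andP[_ yd]; apply: (Nk y).2.
  have := mulr_ge0 (ler0n R m) (ltW L0); lra.
have [|c [d [Gc Gd /andP[nc cx] /andP[xd _] cdA]]] :=
  finitary_contains fA Ax Gn Gp _.
  by rewrite nx.
apply: (progress c d L) => //; [by left|exact: le_lt_trans xd|].
move=> y m /andP[cy _]; apply: (Nk y).1.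
have := mulr_ge0 (ler0n R m) (ltW L0); lra.
Qed.

Lemma finitary_value A : finitary E A -> (lambda A < +oo)%E ->
  exists v, [/\ G v, 0 <= v & lambda A = v%:E].
Proof.
move=> fA /(finitary_bounded fA) [n An]; have [Gm Gn] := G_box n.
have [v [Gv v0 vE _]] := pieced_chop (pieced_finitary fA Gm Gn (box_bounds n)).
by exists v; split=> //; rewrite -vE setIidl.
Qed.

(** Without such an interval, every interval too short to carry all of [A] meets [A] in a null set.
    Cutting the boxes into short intervals makes [A] null. *)
Lemma itvco_splits A : measurable A -> (0 < lambda A)%E ->
  exists a b, [/\ G a, G b & (0 < lambda (A `&` `[a, b[%classic) < lambda A)%E].
Proof.
move=> mA A0; apply: contrapT => noab.
(* Since [lambda A] may be infinite, a finite lower bound takes its place. *)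
have [e e0 eA] : exists2 e, 0 < e & (e%:E <= lambda A)%E.
  move: A0; case: (lambda A) => [r|_|//]; first by rewrite lte_fin; exists r.
  by exists 1; rewrite ?leey.
have [c Gc /andP[c0 ce]] := Gsmall e0.
have null a b : G a -> G b -> a <= b -> lambda (A `&` `[a, b[%classic) = 0%E.
  move=> Ga Gb ab; have mAI u v : measurable (A `&` `[u, v[%classic).
    by apply: measurableI => //; exact: measurable_itv.
  move: (pieced_grid G0 GB G0 Gc c0 Ga Gb ab) => {Ga Gb ab}.
  elim=> [{}a {}b Ga Gb ab [z [za bz]]|{}a {}b d Pab ab0 Pbd bd0].
    apply/eqP; rewrite eq_le measure_ge0 andbT leNgt; apply/negP => ab0.
    apply: noab; exists a, b; split=> //; rewrite ab0/=.
    apply: (@le_lt_trans _ _ (b - a)%:E).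
      by rewrite -lebesgue_measure_itvco// le_measure// inE//; exact: measurable_itv.
    apply: lt_le_trans eA; rewrite lte_fin; apply: le_lt_trans ce.
    by move: za bz; rewrite intrD; lra.
  have [_ _ leab] := pieced_bounds Pab; have [_ _ lebd] := pieced_bounds Pbd.
  by rewrite (@measure_setI_itvco_cat _ _ b) ?leab// ab0 bd0 adde0.
have [n] := measure_box mA A0; have [Gm Gn] := G_box n.
by rewrite null ?ltxx//; exact: box_bounds.
Qed.

(** * The measure on the space of itineraries *)

Local Notation X := (itinerary R E).
Local Notation j := (@encode R R E).

(** The preimage of an open set is a countable union of finitary sets. *)
Lemma enitinerary_measurable :
  measurable_fun [set: measurableTypeR R] (j : measurableTypeR R -> borel X).
Proof.
apply: (@measurability _ _ (measurableTypeR R) (borel X) setT j (@open X)) => //.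
move=> _ [U oU <-].
rewrite setTI; have [F FU ->] := open_bigcup_depends oU.
by apply: bigcup_measurable => n _; apply: finitary_measurable; exists n.
Qed.

Lemma finitary_interval A x : finitary E A -> A x ->
  exists a b, [/\ G a, G b, a < b & `[a, b[%classic `<=` A].
Proof.
move=> fA Ax; have [n xn] := box_exists x; have [Gm Gn] := G_box n.
have [c [d [Gc Gd /andP[_ cx] /andP[xd _] cdA]]] := finitary_contains fA Ax Gm Gn xn.
by exists c, d; split=> //; exact: le_lt_trans xd.
Qed.

Lemma itinerary_cantor_like : cantor_like X.
Proof.
split; [|exact: itinerary_compact|exact: itinerary_hausdorff|exact: itinerary_zero_dimensional].
apply: itinerary_perfect => n w.
(* This set contains an interval, and a ray starting inside that interval separates two of its
   points; one of the two is on the other side from [w]. *)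
pose A : set R := [set v | forall i, (i < n)%N -> E i w = E i v].
have fA : finitary E A by exists n => u v uv wu i ilt; rewrite -uv// wu.
have [a [b [Ga Gb ab abA]]] := @finitary_interval A w fA (fun _ _ => erefl).
have [c Gc /andP[c0 cab]] := @Gsmall (b - a) ltac:(by rewrite subr_gt0).
have [i iE] := Eray (subgroupD G0 GB Ga Gc).
have Aa : A a by apply: abA; rewrite /= in_itv/= lexx.
have Aac : A (a + c) by apply: abA; rewrite /= in_itv/=; lra.
have Ei : E i a != E i (a + c) by rewrite !iE lexx gerDl leNgt c0.
have [wi|wi] := eqVneq (E i a) (E i w); last by exists a => //; exists i.
by exists (a + c) => //; exists i; rewrite eq_sym -wi.
Qed.

Section itinerary_measure.
Variable mu : {measure set (borel X) -> \bar R}.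
Hypothesis muE : forall A : set (borel X), mu A = lambda (j @^-1` A).

Lemma itinerary_measure_full : full_measure mu.
Proof.
move=> U oU U0; have [V cV [VU [w Vw]]] := open_meets_encode oU U0.
have [a [b [_ _ ab abV]]] := finitary_interval (clopen_depends cV) Vw.
rewrite muE; apply: (@lt_le_trans _ _ (lambda `[a, b[%classic)).
  by rewrite lebesgue_measure_itvco ?(ltW ab)// lte_fin subr_gt0.
apply: le_measure; rewrite ?inE; [exact: measurable_itv| |].
  rewrite -[X in measurable X]setTI; apply: enitinerary_measurable => //.
  exact: sub_sigma_algebra.
by move=> x /abV /VU.
Qed.

(** An interval splitting the preimage of [A] corresponds to a clopen set splitting [A]. *)
Lemma itinerary_measure_non_atomic : non_atomic mu.
Proof.
move=> A [mA A0 atomA]; have mjA : measurable (j @^-1` A).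
  by rewrite -[X in measurable X]setTI; exact: enitinerary_measurable.
have [|a [b [Ga Gb /andP[ab0 abA]]]] := itvco_splits mjA; first by rewrite -muE.
have [n nab] := finitary_itvco Ga Gb.
have [V [oV _] VE] := @depends_clopen R _ _ _ _ nab.
have jAV : j @^-1` (A `&` V) = j @^-1` A `&` `[a, b[%classic.
  by rewrite preimage_setI VE.
have : mu (A `&` V) = 0%E.
  apply: atomA; [|by move=> x []|by rewrite !muE jAV].
  by apply: measurableI => //; exact: sub_sigma_algebra.
by move=> AV0; move: ab0; rewrite -jAV -muE AV0 ltxx.
Qed.

Lemma itinerary_measure_M_infty : M_infty mu.
Proof.
split; [exact: itinerary_measure_full|exact: itinerary_measure_non_atomic|].
by rewrite muE preimage_setT -set_itvNyy lebesgue_measure_itv.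
Qed.

(** The measure sees only encoded points, and each of these lies in the clopen set of some box,
    which has finite measure. *)
Lemma itinerary_measure_non_defective : non_defective mu.
Proof.
rewrite /non_defective muE.
suff -> : j @^-1` defective_set mu = set0 by exact: measure0.
rewrite -subset0 => x defx; have [n xn] := box_exists x.
have [m nm] := finitary_box n; have [V cV VE] := @depends_clopen R _ _ _ _ nm.
have := defx V cV; rewrite muE VE lebesgue_measure_itvco ?box_bounds//.
by have : box n x by []; rewrite -VE => Vx /(_ Vx).
Qed.

Lemma itinerary_measure_good : good_measure mu.
Proof.
move=> U V cU cV UV; have fU := clopen_depends cU; have fV := clopen_depends cV.
have Ufin : (lambda (j @^-1` U) < +oo)%E.
  by rewrite -muE (lt_le_trans UV)// leey.
have [v [Gv v0 vE]] := finitary_value fU Ufin.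
have [|B [[n nB] BV BE]] := finitary_chop fV Gv v0; first by rewrite -vE -!muE.
have [W cW WE] := @depends_clopen R _ _ _ _ nB.
exists W; split=> //; last by rewrite !muE WE BE vE.
by apply: clopen_subset => //; rewrite WE.
Qed.

Lemma itinerary_measure_clopen_values : clopen_values mu = [set x | G x /\ 0 <= x].
Proof.
apply/seteqP; split=> [_ [U [cU Ufin] <-]|x [Gx x0]].
  rewrite muE in Ufin; have [v [Gv v0 vE]] := finitary_value (clopen_depends cU) Ufin.
  by rewrite muE vE.
have [n nx] := finitary_itvco G0 Gx.
have [V cV VE] := @depends_clopen R _ _ _ _ nx.
have muV : mu V = x%:E by rewrite muE VE lebesgue_measure_itvco// subr0.
by exists V; [split; rewrite // muV ltry | rewrite muV].
Qed.

End itinerary_measure.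

(** By [bit_neg] the flip persists at limit points: for [n > 0], some bit of [iter n T x] is
    opposite to that of [x], so no iterate has a fixed point. *)
Lemma reitinerary_aperiodic (s : nat -> nat)
    (sE : forall i x, E (s i) x = E i (x + g)) :
  (forall n, (0 < n)%N -> exists i, forall x, E i (x + n%:R * g) = ~~ E i x) ->
  aperiodic (recode sE : X -> X).
Proof.
move=> flip; set T := recode sE.
have iterE n (x : X) i : iter n T x i = x (iter n s i).
  by elim: n x i => //= n IHn x i; rewrite IHn /= -iterSr.
have sn n i x : E (iter n s i) x = E i (x + n%:R * g).
  elim: n x => [|n IHn] x /=; first by rewrite mul0r addr0.
  by rewrite sE IHn -natr1 mulrDl mul1r addrAC addrA.
have Tn n (x : X) : (0 < n)%N -> iter n T x <> x.
  move=> /flip [i iE] /(congr1 (fun y : X => y i)).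
  rewrite iterE (@bit_neg _ _ _ _ _ i); last by move=> w; rewrite sn iE.
  by case: (x i).
move=> x; apply: (@sub_infinite_set _ (range (fun n => iter n T x))).
  by move=> _ [n _ <-]; exists n; left.
have inj m n : (m < n)%N -> iter m T x <> iter n T x.
  move=> mn mnE; apply: (Tn (n - m)%N (iter m T x)); first by rewrite subn_gt0.
  by rewrite -iterD subnK 1?ltnW.
move=> /(finite_preimage (f := fun n => iter n T x)) fin.
apply: infinite_nat; apply: sub_finite_set (fin _); first by move=> n _; exists n.
move=> m n _ _ mnE; apply/eqP; case: ltngtP => // [/inj /(_ mnE)//|/inj].
by rewrite mnE => /(_ erefl).
Qed.

Lemma itinerary_system :
    (forall c, G c ->
      exists s : nat -> nat, forall i x, E (s i) x = E i (x + c)) ->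
    (forall n, (0 < n)%N ->
      exists i, forall x, E i (x + n%:R * g) = ~~ E i x) ->
  exists (T : X -> X) (mu : {measure set (borel X) -> \bar R}),
    cantor_like X /\ homeomorphism T /\ aperiodic T /\
    M_infty mu /\ non_defective mu /\ good_measure mu /\
    invariant_measure T mu /\ clopen_values mu = [set x | G x /\ 0 <= x].
Proof.
move=> shift flip; have [s sE] := shift g Gg.
have [s' s'E] := shift (- g) (subgroupN G0 GB Gg).
have [mu muE] := pushforward_measure lambda enitinerary_measurable.
exists (recode sE), mu; split; first exact: itinerary_cantor_like.
split.
  split; first exact: reitinerary_continuous.
  exists (recode s'E); first exact: reitinerary_continuous.
  (* The maps [s] and [s'] need not be mutually inverse on indices; they are so up to equality of
     the functions [E i], which suffices for the bits. *)
  split=> x; apply: itineraryP => i /=; apply: bit_eq => w.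
    by rewrite sE s'E addrK.
  by rewrite s'E sE addrNK.
split; first exact: reitinerary_aperiodic.
split; first exact: itinerary_measure_M_infty.
split; first exact: itinerary_measure_non_defective.
split; first exact: itinerary_measure_good.
split; last exact: itinerary_measure_clopen_values.
move=> A mA; rewrite !muE -[RHS](lebesgue_measure_shift g).
  by congr (lambda _); apply/seteqP; split=> x; rewrite /= reitinerary_encode.
by rewrite -[X in measurable X]setTI; exact: enitinerary_measurable.
Qed.

End interval_algebra.
(** * From group-like sets to subgroups *)

(** The group consists of the [x] with [|x|] in [D]. For [x] and [y] in [D], the subgroup attached
    to an element of [D] beyond [x + y] yields both [x + y] and [|x - y|], which covers all sign
    cases. *)
Lemma group_like_positive_cone (R : realType) (D : set R) : group_like D ->
  exists G : set R, [/\ additive_subgroup G, exists f : nat -> R, range f = G,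
    forall e, 0 < e -> exists2 c, G c & 0 < c < e &
    D = [set x | G x /\ 0 <= x]].
Proof.
move=> [D0 Ddense Dcount Dunbounded DG].
have Dge0 x : D x -> 0 <= x by move=> /D0; rewrite /= in_itv/= andbT.
have Dsub x y : D x -> D y ->
    exists G : set R, [/\ additive_subgroup G, G x, G y &
    forall z, 0 <= z <= x + y -> D z <-> G z].
  move=> Dx Dy; have [w Dw xyw] : exists2 w, D w & x + y < w.
    apply: contrapT => nw; apply: Dunbounded; exists (x + y) => w Dw.
    by rewrite leNgt; apply/negP => xyw; apply: nw; exists w.
  have [G subG GE] := DG w Dw; exists G.
  have DGz z : 0 <= z <= x + y -> D z <-> G z.
    move=> /andP[z0 zxy]; have zw : `[0, w]%classic z.
      by rewrite /= in_itv/= z0 (le_trans zxy)// ltW.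
    split=> Gz; first by have [] : (G `&` `[0, w]) z by rewrite -GE.
    by have [] : (D `&` `[0, w]) z by rewrite GE.
  by split=> //; apply/DGz => //; rewrite Dge0// ?lerDl ?lerDr Dge0.
have Dadd x y : D x -> D y -> D (x + y).
  move=> Dx Dy; have [G [[G0 GB] Gx Gy DGE]] := Dsub x y Dx Dy.
  by apply/DGE; [rewrite addr_ge0 ?Dge0/=|exact: subgroupD].
have Dabs x y : D x -> D y -> D `|x - y|.
  move=> Dx Dy; have [G [[G0 GB] Gx Gy DGE]] := Dsub x y Dx Dy.
  apply/DGE.
    by rewrite normr_ge0/= (le_trans (ler_normB _ _))// !ger0_norm ?Dge0.
  by case: (ger0P (x - y)) => _; rewrite ?opprB; exact: GB.
have [x0 Dx0] : D !=set0.
  apply/set0P/eqP => D_0; apply: Dunbounded; exists 0 => x; rewrite D_0.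
  by case.
exists [set x | D `|x|]; split.
- split; first by have := Dabs _ _ Dx0 Dx0; rewrite subrr.
  move=> x y /= Dx Dy; case: (ger0P x) Dx => x_0; case: (ger0P y) Dy => y_0 Dy Dx.
  + exact: Dabs.
  + by rewrite ger0_norm; [exact: Dadd|rewrite addr_ge0// ltW// oppr_gt0].
  + by rewrite ltr0_norm ?opprB ?opprD// addrC; [exact: Dadd|lra].
  + by have := Dabs _ _ Dx Dy; rewrite -opprD normrN.
- have /pcard_surjP [h hD] := Dcount.
  (* Even and odd indices list the elements of [D] and their opposites; [x0] replaces values of [h]
     outside [D]. *)
  pose f n := let x := h n./2 in
    if `[< D x >] then if odd n then - x else x else x0.
  exists f; apply/seteqP; split=> [_ [n _ <-]|x /= Dx].
    rewrite /f/=; case: asboolP => [Dh|_]; last by rewrite ger0_norm ?Dge0.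
    by case: odd; rewrite ?normrN ger0_norm ?Dge0.
  have [n _ nx] := hD _ Dx; exists ((x < 0)%R + n.*2)%N => //.
  rewrite /f half_bit_double nx asboolT// oddD odd_double addbF.
  by case: ltrP => x_0 /=; [rewrite ltr0_norm ?opprK|rewrite ger0_norm].
- move=> e e0; have /Ddense /(_ (ball (e / 2) (e / 2))) : `[0, +oo[%classic (e / 2).
    by rewrite /= in_itv/= andbT ltW// divr_gt0.
  case=> [|d [Dd]]; first by apply: nbhsx_ballx; rewrite divr_gt0.
  rewrite /ball/= ltr_distlC => /andP[d1 d2]; exists d.
    by rewrite /= ger0_norm// Dge0.
  by apply/andP; split; lra.
- apply/seteqP; split=> x /=; first by move=> Dx; rewrite ger0_norm ?Dge0.
  by move=> [+ x_0]; rewrite ger0_norm.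
Qed.

Lemma odd_abszD (y z : int) : odd `|(y + z)%R|%N = odd `|y|%N (+) odd `|z|%N.
Proof. lia. Qed.

Lemma floor_shift (R : realType) (x s h : R) (z : int) : 0 < h ->
  Num.floor ((x + z%:~R * h - s) / h) = Num.floor ((x - s) / h) + z.
Proof.
move=> h0; have -> : (x + z%:~R * h - s) / h = (x - s) / h + z%:~R.
  by field; rewrite gt_eqF.
by rewrite floorDrz ?intr_int// intrKfloor.
Qed.

(** * The family of rays and square waves *)

Section generators.
Context (R : realType) (G : set R) (f : nat -> R) (g : R).
Hypotheses (G0 : G 0) (GB : forall x y, G x -> G y -> G (x - y)).
Hypotheses (Gg : G g) (g0 : 0 < g) (rangef : range f = G).

(* [floor (y / h)] is odd on the half-periods of a square wave of period [2 h].
   The default case of [odflt] only repeats the ray of index [0]. *)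
Definition generator (i : nat) (x : R) : bool :=
  match odflt (inl 0%N) (unpickle i : option (nat + nat * nat)) with
  | inl n => f n <= x
  | inr (k, n) => odd `|Num.floor ((x - f n) / (2 ^+ k * g))|%N
  end.

Let scale_gt0 k : 0 < 2 ^+ k * g.
Proof. by rewrite mulr_gt0// exprn_gt0. Qed.

Lemma generator_piece i a b : G a -> G b -> a <= b ->
  pieced G (constant_on (generator i)) a b.
Proof.
move=> Ga Gb ab; rewrite /generator; case: (odflt _ _) => [n|[k n]].
- by apply: pieced_ray => //; rewrite -rangef; exists n.
- apply: (pieced_floor G0 GB (fun z : int => odd `|z|%N)) => //.
    by rewrite -rangef; exists n.
  by rewrite -natrX; exact: subgroupMn.
Qed.

Lemma generator_ray a : G a -> exists i, forall x, generator i x = (a <= x).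
Proof.
rewrite -rangef => -[n _ <-]; exists (pickle (inl n : nat + nat * nat)%type).
by move=> x; rewrite /generator pickleK.
Qed.

(** A ray is constant on each side of its end point. A wave with half-period [2 ^+ k * g] is
    invariant under an even number of half-periods, such as [2 ^+ m * g] for [m > k]. *)
Lemma generator_periodic i : exists N k : nat,
  forall m, (k <= m)%N -> forall x : R,
    (N%:R <= x -> generator i (x + 2 ^+ m * g) = generator i x) /\
    (x < - N%:R -> generator i (x - 2 ^+ m * g) = generator i x).
Proof.
rewrite /generator; case: (odflt _ _) => [n|[k n]].
- exists (Num.bound `|f n|), 0%N => m _ x.
  have := archi_boundP (normr_ge0 (f n)); set N := _%:R => fN.
  have L0 := scale_gt0 m; have := ler_norm (f n); have := ler_norm (- f n).
  rewrite normrN => f1 f2; split=> xN; apply/idP/idP => //; lra.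
- exists 0%N, k.+1 => m km x.
  suff per y : odd `|Num.floor ((y + 2 ^+ m * g - f n) / (2 ^+ k * g))|%N =
               odd `|Num.floor ((y - f n) / (2 ^+ k * g))|%N.
    by split=> _; rewrite // -(per (x - _)) subrK.
  have -> : 2 ^+ m * g = (2 ^ (m - k))%:Z%:~R * (2 ^+ k * g).
    by rewrite -pmulrn natrX mulrA -exprD subnK// ltnW.
  by rewrite floor_shift// odd_abszD absz_nat oddX subn_eq0 leqNgt km addbF.
Qed.

(** The end point or phase [f n] becomes [f n - c], which is again in the range of [f]. *)
Lemma generator_shift c : G c ->
  exists s : nat -> nat, forall i x, generator (s i) x = generator i (x + c).
Proof.
move=> Gc.
suff : forall i, exists j, forall x, generator j x = generator i (x + c).
  by move=> /choice [s sP]; exists s.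
have fB n : exists n', f n' = f n - c.
  have : G (f n - c) by apply: GB => //; rewrite -rangef; exists n.
  by rewrite -rangef => -[n' _ <-]; exists n'.
move=> i; rewrite {2}/generator; case: (odflt _ _) => [n|[k n]].
- have [n' n'E] := fB n; exists (pickle (inl n' : nat + nat * nat)%type) => x.
  by rewrite /generator pickleK /= n'E lerBlDr.
- have [n' n'E] := fB n; exists (pickle (inr (k, n') : nat + nat * nat)%type) => x.
  by rewrite /generator pickleK /= n'E opprB addrA.
Qed.

(** Let [2 ^ k] be the exact power of 2 dividing [n]. Then [n%:R * g] is an odd number of
    half-periods [2 ^+ k * g]. *)
Lemma generator_flip n : (0 < n)%N ->
  exists i, forall x, generator i (x + n%:R * g) = ~~ generator i x.
Proof.
move=> n0; have [m cop nE] := pfactor_coprime (isT : prime 2) n0.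
have oddm : odd m by rewrite -coprime2n.
have [n' _ n'E] : range f 0 by rewrite rangef.
exists (pickle (inr (logn 2 n, n') : nat + nat * nat)%type) => x.
rewrite /generator pickleK /=.
have -> : n%:R * g = m%:Z%:~R * (2 ^+ logn 2 n * g).
  by rewrite -pmulrn {1}nE natrM natrX mulrA.
by rewrite floor_shift// odd_abszD absz_nat oddm addbT.
Qed.

End generators.

Theorem corollary2p17 (R : realType) (D : set R) (hD : group_like D) :
  exists (X : pmetricType R) (T : X -> X)
         (mu : {measure set (borel X) -> \bar R}),
    cantor_like X /\
    homeomorphism T /\ aperiodic T /\
    M_infty mu /\ non_defective mu /\ good_measure mu /\
    invariant_measure T mu /\
    clopen_values mu = D.
Proof.
have [G [[G0 GB] [f fG] Gsmall ->]] := group_like_positive_cone hD.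
have [g Gg /andP[g0 _]] := Gsmall 1 ltr01.
exists (itinerary R (generator f g)).
apply: (itinerary_system G0 GB Gg g0 Gsmall).
- exact: generator_piece.
- exact: generator_ray.
- exact: generator_periodic.
- exact: generator_shift.
- exact: (generator_flip G0 g0 fG).
Qed.
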